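(* Fix a real number $\alpha$ with $0<\alpha<1$ and an integer $n\ge 4$. (i) For every connected unicyclic graph $G$ on $n$ vertices with diameter $2$, $SO_{\alpha}(G)\le SO_{\alpha}(C_2(3,n-3,0))$, with equality if and only if $G\cong C_2(3,n-3,0)$. (ii) For every connected unicyclic graph $G$ on $n$ vertices with diameter $3$, $SO_{\alpha}(G)\le SO_{\alpha}(C_3(3,n-4,1))$, with equality if and only if $G\cong C_3(3,n-4,1)$.
   Context: All graphs are finite and simple; $d_G(v)$ denotes the degree of a vertex $v$ in $G$. The general Sombor index is $SO_{\alpha}(G)=\sum_{uv\in E(G)}\left(d_G(u)^2+d_G(v)^2\right)^{\alpha}$. A unicyclic graph is a connected graph containing exactly one cycle. $C_2(3,n-3,0)$ is the graph obtained from a triangle by attaching $n-3$ pendant vertices (new vertices of degree one) to one vertex of the triangle. $C_3(3,n-4,1)$ is the graph obtained from a triangle with vertices $a,b,c$ by attaching $n-4$ pendant vertices to $a$ and one pendant vertex to $b$. *)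

(* Defs.v *)
From HB Require Import structures.
From mathcomp Require Import all_boot all_order all_algebra.
From mathcomp Require Import reals exp.

Set Implicit Arguments.
Unset Strict Implicit.
Unset Printing Implicit Defensive.

Record sgraph := SGraph {
  vertex :> finType;
  adj : rel vertex;
  adj_sym : symmetric adj;
  adj_irrefl : irreflexive adj }.

Arguments adj {s} _ _.

Section GraphNotions.
Variable G : sgraph.
Implicit Types (x y : G) (k : nat).

Definition deg x : nat := #|[set y | adj x y]|.

Definition edges : {set {set G}} :=
  [set [set p.1; p.2] | p : G * G & adj p.1 p.2].

Definition connected_graph : Prop := forall x y, connect adj x y.

(* A cycle is a subgraph, identified with its edge set, so that the closed
   walks obtained from one another by rotation or reversal are one cycle. *)
Definition is_cycle (C : {set {set G}}) : Prop :=
  exists c : seq G,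
    [/\ 3 <= size c, ucycle adj c & C = [set [set x; next c x] | x in c]].

Definition unicyclic : Prop :=
  connected_graph /\ exists! C : {set {set G}}, is_cycle C.

Definition has_walk k x y : bool :=
  [exists p : k.-tuple G, path adj x p && (last x p == y)].

(* The least k < #|G| with a walk of k edges from x to y; it is #|G| when x
   and y lie in different components. *)
Definition dist x y : nat := find (fun k => has_walk k x y) (iota 0 #|G|).

Definition diameter : nat := \max_x \max_y dist x y.

End GraphNotions.

Definition isomorphic (G H : sgraph) : Prop :=
  exists f : G -> H, bijective f /\ forall x y, adj (f x) (f y) = adj x y.

(* The inner sum runs over the two ends of the edge e. *)
Definition SO (R : realType) (alpha : R) (G : sgraph) : R :=
  (\sum_(e in edges G) ((\sum_(v in e) deg v ^ 2)%N%:R `^ alpha))%R.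

Section Pendant.
Variables (G : sgraph) (v : G) (m : nat).

Definition pendant_adj : rel (G + 'I_m)%type := fun a b =>
  match a, b with
  | inl x, inl y => adj x y
  | inl x, inr _ => x == v
  | inr _, inl y => y == v
  | inr _, inr _ => false
  end.

Lemma pendant_adj_sym : symmetric pendant_adj.
Proof. by case=> [x|i] [y|j] //=; apply: adj_sym. Qed.

Lemma pendant_adj_irrefl : irreflexive pendant_adj.
Proof. by case=> [x|i] //=; apply: adj_irrefl. Qed.

Definition attach_pendants : sgraph :=
  SGraph pendant_adj_sym pendant_adj_irrefl.

End Pendant.

Lemma triangle_sym : symmetric (fun i j : 'I_3 => i != j).
Proof. by move=> i j; rewrite eq_sym. Qed.

Lemma triangle_irrefl : irreflexive (fun i j : 'I_3 => i != j).
Proof. by move=> i; rewrite eqxx. Qed.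

Definition triangle : sgraph := SGraph triangle_sym triangle_irrefl.

Definition tri_a : triangle := @Ordinal 3 0 isT.
Definition tri_b : triangle := @Ordinal 3 1 isT.

(* C2_3 p is $C_2(3,p,0)$ and C3_3 p q is $C_3(3,p,q)$. *)
Definition C2_3 (p : nat) : sgraph := attach_pendants tri_a p.

Definition C3_3 (p q : nat) : sgraph :=
  @attach_pendants (attach_pendants tri_a p) (inl tri_b) q.

(* Main.v *)
(** A unicyclic graph on n vertices has n edges. Let a be a vertex of maximal
    degree D, and m = n - D the number of edges avoiding a. If m = 1, or if m = 2
    and some other vertex has degree 3, the graph is C_2(3,n-3,0), respectively
    C_3(3,n-4,1). In all other cases its index is smaller than that of
    C_3(3,n-4,1), whose edge weights d(u)^2+d(v)^2 are 13, 10 and n-2 numbers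
    that are at least M = (n-2)^2+1.

    If m = 2 and all other degrees are at most 2, this is a comparison term by
    term. If m >= 3, concavity of x^alpha bounds the index by n Q^alpha, where Q
    is at least the mean weight (the sum of d(v)^3 over v, divided by n), and the
    AM-GM inequality gives n Q^alpha <= (n-2) M^alpha + 13^alpha + 10^alpha as soon
    as Q^n <= 130 M^(n-2). For D close to n this last inequality fails, but then
    the edges at a have weight at most M, and the other m edges have weight at
    most (m+1)^2+4, so that AM-GM is only needed for those. *)

Require Import Defs.
From HB Require Import structures.
From mathcomp Require Import all_boot all_order all_algebra.
From mathcomp Require Import reals sequences exp.
From mathcomp Require Import zify ring lra.

Set Implicit Arguments.
Unset Strict Implicit.
Unset Printing Implicit Defensive.
Import Order.TTheory GRing.Theory Num.Theory.

(** * Unicyclic graphs have as many edges as vertices *)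

Section Trees.
Variable G : sgraph.
Implicit Types (x y u v r : G).

Lemma set2_inj x y u v :
  [set x; y] = [set u; v] -> (x = u /\ y = v) \/ (x = v /\ y = u).
Proof.
move=> /setP E.
have := E x; rewrite !inE eqxx /= => /esym/orP[]/eqP xe;
have := E y; rewrite !inE eqxx orbT => /esym/orP[]/eqP ye; subst; auto.
  by have := E v; rewrite !inE eqxx orbT orbb => /eqP->; auto.
by have := E u; rewrite !inE eqxx orbb => /eqP->; auto.
Qed.

Lemma edgesP e :
  reflect (exists x y, e = [set x; y] /\ adj x y) (e \in edges G).
Proof.
apply: (iffP imsetP) => [[[x y]] |[x [y [-> xy]]]].
  by rewrite inE /= => xy ->; exists x, y.
by exists (x, y); rewrite ?inE.
Qed.

Lemma mem_edges x y : ([set x; y] \in edges G) = adj x y.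
Proof.
apply/edgesP/idP => [[u [v [/set2_inj E uv]]]|xy]; last by exists x, y.
by case: E => [[-> ->]|[-> ->]] //; rewrite adj_sym.
Qed.

Lemma adj_neq x y : adj x y -> x != y.
Proof. by apply: contraTneq => ->; rewrite adj_irrefl. Qed.

(** A repetition-free path of [T] from [u] to [v], closed by the edge [uv], is a cycle. It has at
    least three vertices because a path of one edge would put [uv] into [T]. Since [C] lies in [T]
    plus [uv], cycles of different edges outside [T] differ. *)
Lemma fundamental_cycle (T : {set {set G}}) u v :
  T \subset edges G -> adj u v -> [set u; v] \notin T ->
  connect (fun x y => [set x; y] \in T) u v ->
  exists2 C : {set {set G}}, is_cycle C &
    [set u; v] \in C /\ C \subset [set u; v] |: T.
Proof.
move=> /subsetP TE uv uvT /connectP[p0 up0 lp0].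
case/shortenP: up0 lp0 => p up uniqp _ {p0} vE.
case/lastP: p up uniqp vE => [|p v'] up uniqp vE.
  by rewrite vE adj_irrefl in uv.
move: vE; rewrite last_rcons => vE; subst v'.
set e := fun x y => [set x; y] \in [set u; v] |: T.
(* The relation [e] keeps track of which edges the closed walk uses; this later gives the inclusion
   of [C]. *)
have ce : cycle e [:: v, u & p].
  rewrite /= {1}/e setUC setU11 /=; apply: sub_path up => x y xy.
  by rewrite /e inE xy orbT.
exists [set [set x; next [:: v, u & p] x] | x in [:: v, u & p]].
  exists [:: v, u & p]; split=> //.
    case: p up {uniqp ce} => //=; rewrite andbT => uvT'.
    by rewrite uvT' in uvT.
  apply/andP; split.
    apply: sub_cycle ce => x y; rewrite /e !inE => /orP[/eqP E|/TE].
      by rewrite -mem_edges E mem_edges.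
    by rewrite mem_edges.
  by rewrite -rcons_cons rcons_uniq in uniqp.
split.
  apply/imsetP; exists v; first by rewrite inE eqxx.
  by rewrite /= eqxx setUC.
by apply/subsetP=> _ /imsetP[x xc ->]; apply: (next_cycle ce).
Qed.

(** Rotate the cycle to start x, y, z: if y were also the predecessor of x, then the successor z of
    y would be x. *)
Lemma next_neq_prev (c : seq G) x :
  2 < size c -> uniq c -> x \in c -> next c x != prev c x.
Proof.
move=> sc uc xc; apply/eqP => np.
have := next_prev uc x; rewrite -np.
case/rot_to: xc => i s Es; rewrite -!(next_rot i uc) Es.
have := uc; rewrite -(rot_uniq i) Es.
have: 2 < size (x :: s) by rewrite -Es size_rot.
case: s {Es} => [|y [|z s]] //= _ /and3P[]; rewrite !inE !negb_or.
case/and3P=> xy xz _ _ _; rewrite eqxx [y == x]eq_sym (negPf xy) eqxx => zx.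
by rewrite zx eqxx in xz.
Qed.

(** A spanning tree rooted at [r], encoded by a parent map [p] along which the height [h]
    decreases. *)
Variables (r : G) (h : G -> nat) (p : G -> G).
Hypothesis parentP : forall v, v != r -> adj v (p v) && (h (p v) < h v).

Let tree := [set [set v; p v] | v in [set~ r]].

Lemma tree_edges : tree \subset edges G.
Proof.
apply/subsetP=> _ /imsetP[v vr ->]; rewrite mem_edges.
by move: vr; rewrite !inE => /parentP/andP[].
Qed.

(** Each vertex other than [r] owns its parent edge: if two vertices shared one, each would be the
    parent of the other, hence lower than the other. *)
Lemma tree_card : #|tree| = #|G|.-1.
Proof.
rewrite card_in_imset ?cardsC1 // => u v.
rewrite !inE => /parentP/andP[_ hu] /parentP/andP[_ hv] /set2_inj[[]//|[E1 E2]].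
by move: hu hv; rewrite E2 -E1; lia.
Qed.

Lemma tree_connect v : connect (fun x y => [set x; y] \in tree) v r.
Proof.
have [k] := ubnP (h v); elim: k v => // k IH v hv.
have [->//|vr] := eqVneq v r.
have /andP[_ hp] := parentP vr.
apply: connect_trans (IH (p v) _); last by lia.
by apply: connect1; apply/imsetP; exists v; rewrite ?inE.
Qed.

Lemma tree_connect2 u v : connect (fun x y => [set x; y] \in tree) u v.
Proof.
apply: connect_trans (tree_connect u) _.
by rewrite sym_connect_sym ?tree_connect // => x y; rewrite setUC.
Qed.

(** Exactly one edge lies outside the tree. Two such edges would have different fundamental cycles;
    with none, a highest vertex of the cycle would have its parent as both neighbours on it. *)
Lemma unicyclic_card_edges_of_parent :
  (exists! C : {set {set G}}, is_cycle C) -> #|edges G| = #|G|.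
Proof.
case=> C [isC uniqC].
have nontree_le1 : #|edges G :\: tree| <= 1.
  apply/card_le1_eqP => e e'; rewrite !inE => /andP[et /edgesP[x [y [E xy]]]].
  case/andP=> et' /edgesP[x' [y' [E' xy']]]; subst.
  have [D isD [inD subD]] := fundamental_cycle tree_edges xy et (tree_connect2 x y).
  have [D' isD' [inD' _]] :=
    fundamental_cycle tree_edges xy' et' (tree_connect2 x' y').
  have DD' : D' = D by rewrite -(uniqC _ isD) -(uniqC _ isD').
  (* The second edge lies on the fundamental cycle of the first, which has a single edge outside the
     tree. *)
  move: (subsetP subD [set x'; y']); rewrite -DD' => /(_ inD').
  by rewrite !inE (negPf et') orbF => /eqP.
have nontree_gt0 : 0 < #|edges G :\: tree|.
  rewrite card_gt0; apply/negP; rewrite setD_eq0 => /subsetP Et.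
  case: isC => c [sc /andP[cc uc] _].
  case: c sc cc uc => // x0 c sc cc uc.
  have x0c : x0 \in x0 :: c by rewrite inE eqxx.
  case: (@arg_maxnP _ x0 (mem (x0 :: c)) h x0c) => x xc xmax.
  have to_parent y : y \in x0 :: c -> adj x y -> y = p x.
    move=> yc; rewrite -mem_edges => /Et/imsetP[z]; rewrite !inE => zr.
    case/set2_inj => [[-> ->]//|[xE yE]]; subst.
    have /andP[_] := parentP zr.
    by rewrite ltnNge => /negP[]; apply: xmax.
  have := next_neq_prev sc uc xc.
  rewrite (to_parent (next _ x)) ?mem_next ?next_cycle //.
  by rewrite (to_parent (prev _ x)) ?mem_prev ?eqxx // adj_sym prev_cycle.
have E := cardsID tree (edges G); rewrite (setIidPr tree_edges) tree_card in E.
have rG : 0 < #|G| by apply/card_gt0P; exists r.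
have k1 : #|edges G :\: tree| = 1.
  by apply/eqP; rewrite eqn_leq nontree_le1 nontree_gt0.
by rewrite -E k1 addn1 prednK.
Qed.

End Trees.

(** Breadth-first search: [h v] is the least length of a walk from [r] to [v], and the last vertex
    but one of such a walk is a lower neighbour of [v]. *)
Lemma connected_parent (G : sgraph) (r : G) : connected_graph G ->
  exists (h : G -> nat) (p : G -> G),
    forall v, v != r -> adj v (p v) && (h (p v) < h v).
Proof.
move=> conG.
have walks v : exists k, has_walk k r v.
  have /connectP[s rs vE] := conG r v.
  by exists (size s); apply/existsP; exists (in_tuple s); rewrite rs -vE eqxx.
pose h v := ex_minn (walks v).
pose p v := odflt v [pick u | adj v u && (h u < h v)].
exists h, p => v vr; rewrite /p; case: pickP => //= noparent.
have [u /andP[uv huv]] : exists u, adj v u && (h u < h v).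
  rewrite {2}/h; case: ex_minnP => k /existsP[[s sk] /= /andP[rs /eqP vE]] _.
  case/lastP: s sk rs vE => [|s v'] sk rs vE; first by rewrite -vE eqxx in vr.
  move: rs vE; rewrite last_rcons rcons_path => /andP[rs sv] vE; subst v'.
  exists (last r s); rewrite adj_sym sv /= /h; case: ex_minnP => j _ jmin.
  move: sk; rewrite size_rcons => /eqP <-; rewrite ltnS; apply: jmin.
  by apply/existsP; exists (in_tuple s); rewrite rs eqxx.
by have := noparent u; rewrite uv huv.
Qed.

Lemma unicyclic_card_edges (G : sgraph) : unicyclic G -> #|edges G| = #|G|.
Proof.
case=> conG uG; have [C [[c [c3 _ _]] _]] := uG.
case: c c3 => // r c _; have [h [p ph]] := connected_parent r conG.
exact: unicyclic_card_edges_of_parent ph uG.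
Qed.

(** * Counting edges and degrees *)

Section EdgeCounting.
Variable G : sgraph.
Implicit Types (x y u v a : G) (e : {set G}).

Definition edges_at v := [set e in edges G | v \in e].

Lemma card_edges_at v : #|edges_at v| = deg v.
Proof.
rewrite /deg -(card_in_imset (f := fun y => [set v; y])).
  apply: eq_card => e; rewrite inE; apply/andP/imsetP.
    case=> /edgesP[x [y [-> xy]]]; rewrite !inE => /orP[]/eqP->.
      by exists y; rewrite ?inE.
    by exists x; rewrite ?inE 1?setUC // adj_sym.
  case=> y; rewrite inE => vy ->; rewrite mem_edges vy; split=> //.
  by rewrite !inE eqxx.
move=> y z _ _ /set2_inj[[]//|[<- ->]]//.
Qed.

(** Double counting of incidences. With [g] constant 1 it is the handshake lemma; with the squared
    degree it turns the total edge weight into the sum of the cubed degrees. *)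
Lemma sum_edges_endpoints (g : G -> nat) :
  \sum_(e in edges G) \sum_(v in e) g v = \sum_v deg v * g v.
Proof.
rewrite (exchange_big_dep predT) //=; apply: eq_bigr => v _.
rewrite sum_nat_const -card_edges_at; congr (_ * _).
by apply: eq_card => e; rewrite !inE.
Qed.

Lemma sum_deg : \sum_(v : G) deg v = 2 * #|edges G|.
Proof.
have := sum_edges_endpoints (fun=> 1); under [RHS]eq_bigr do rewrite muln1.
move=> <-; rewrite mulnC -sum_nat_const; apply: eq_bigr => e /edgesP[x [y [-> xy]]].
by rewrite sum1_card cards2 (adj_neq xy).
Qed.

Lemma sum_endpoints x y (g : G -> nat) : adj x y ->
  \sum_(v in [set x; y]) g v = g x + g y.
Proof.
by move=> xy; rewrite big_setU1 ?inE ?adj_neq //= big_set1.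
Qed.

Lemma edges_at_cap u v : u != v -> edges_at u :&: edges_at v \subset [set [set u; v]].
Proof.
move=> uv; apply/subsetP=> e; rewrite !inE.
case/andP=> /andP[/edgesP[x [y [-> _]]] ue] /andP[_ ve].
move: ue ve uv; rewrite !inE => /orP[]/eqP-> /orP[]/eqP->; rewrite ?eqxx //.
by rewrite setUC.
Qed.

Lemma card_edges_at_cap u v : u != v -> #|edges_at u :&: edges_at v| <= 1.
Proof. by move=> uv; rewrite -(cards1 [set u; v]) subset_leq_card // edges_at_cap. Qed.

Section FixVertex.
Variable a : G.

Definition edges_off := edges G :\: edges_at a.

Definition off := #|edges_off|.

Lemma card_edges_off : deg a + off = #|edges G|.
Proof.
rewrite /off -card_edges_at -(cardsID (edges_at a) (edges G)).
congr (#|pred_of_set _| + _).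
by apply/esym/setIidPr/subsetP=> e; rewrite inE => /andP[].
Qed.

Lemma card_edges_at_off v : v != a -> deg v <= #|edges_at v :\: edges_at a| + 1.
Proof.
move=> va; rewrite -card_edges_at -(cardsID (edges_at a)) addnC leq_add2l.
exact: card_edges_at_cap.
Qed.

Lemma edges_at_off_sub v : edges_at v :\: edges_at a \subset edges_off.
Proof. by apply: setSD; apply/subsetP=> e; rewrite inE => /andP[]. Qed.

Lemma deg_le_off v : v != a -> deg v <= off + 1.
Proof.
move=> va; apply: leq_trans (card_edges_at_off va) _.
by rewrite leq_add2r subset_leq_card // edges_at_off_sub.
Qed.

(** Each of [u] and [v] has at most one edge to [a], and only the edge [uv] can be counted twice
    among the edges avoiding [a]. *)
Lemma deg_add_le_off u v : u != a -> v != a -> u != v ->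
  deg u + deg v <= off + 3.
Proof.
move=> ua va uv.
have hu := card_edges_at_off ua; have hv := card_edges_at_off va.
have hI := card_edges_at_cap uv.
have: #|(edges_at u :\: edges_at a) :&: (edges_at v :\: edges_at a)| <= 1.
  by apply: leq_trans hI; rewrite subset_leq_card // setISS ?subsetDl.
have: #|(edges_at u :\: edges_at a) :|: (edges_at v :\: edges_at a)| <= off.
  by rewrite subset_leq_card // subUset !edges_at_off_sub.
by rewrite cardsU; lia.
Qed.

Lemma mem_edges_off x y : ([set x; y] \in edges_off) = [&& adj x y, x != a & y != a].
Proof.
rewrite !inE mem_edges; case: adj; rewrite ?andbF //= andbT negb_or.
by rewrite ![a == _]eq_sym.
Qed.

End FixVertex.

Lemma deg_gt0 v : connected_graph G -> 1 < #|G| -> 0 < deg v.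
Proof.
move=> conG /card_gt1P[x [y [_ _ xy]]].
have [w wv] : exists w, w != v.
  by have [xv|] := eqVneq x v; [exists y; rewrite -xv eq_sym | exists x].
have /connectP[[|u p] /=] := conG v w; first by move=> _ E; rewrite E eqxx in wv.
by case/andP=> vu _ _; rewrite card_gt0; apply/set0Pn; exists u; rewrite inE.
Qed.

(** * Degree sums in a connected graph with n vertices and n edges *)

Section Excess.
Variable n : nat.
Hypotheses (conG : connected_graph G) (n_gt1 : 1 < n).
Hypotheses (nG : #|G| = n) (eG : #|edges G| = n).

Let deg_gt0' v : 0 < deg v. Proof. by rewrite deg_gt0 // nG. Qed.

Lemma sum_deg_pred : \sum_(v : G) (deg v).-1 = n.
Proof.
have := sum_deg; rewrite eG.
rewrite (eq_bigr (fun v => (deg v).-1 + 1)); last first.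
  by move=> v _; rewrite addn1 prednK // deg_gt0'.
by rewrite big_split /= sum1_card cardT -cardE nG; lia.
Qed.

Lemma sum_deg_pred_off a : \sum_(v | v != a) (deg v).-1 = off a + 1.
Proof.
have := sum_deg_pred; rewrite (bigD1 a) //= => E.
have := card_edges_off a; rewrite eG; have := deg_gt0' a; lia.
Qed.

(** For 1 <= d <= D, d^3 - d = (d - 1) d (d + 1) <= (d - 1)(D^2 + D). Now sum, using that the
    degrees add up to 2n and the numbers d - 1 to n. *)
Lemma sum_cube_le D : (forall v : G, deg v <= D) ->
  \sum_(v : G) deg v * deg v ^ 2 <= n * (D ^ 2 + D + 2).
Proof.
move=> dD; have E1 := sum_deg; have E2 := sum_deg_pred.
apply: (@leq_trans (\sum_v (deg v + (D ^ 2 + D) * (deg v).-1))).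
  apply: leq_sum => v _; have := dD v; have := deg_gt0' v.
  case: (deg v) => // d _ dle /=.
  have := leq_mul dle (leq_mul dle (leqnn d)).
  have := leq_mul dle (leqnn d). nia.
rewrite big_split /= -big_distrr /= E1 E2 eG; nia.
Qed.

(** The numbers d - 1 over v != a add up to 4. A vertex of degree 4 takes 3 of this, so the other
    degrees are at most 2 and the bound is 64 + (n - 2) + 7. Otherwise d <= 3 and d^3 <= 1 + 13 (d -
    1). *)
Lemma sum_cube_off3 a : off a = 3 ->
  \sum_(v | v != a) deg v * deg v ^ 2 <= n + 69.
Proof.
move=> off3; have E := sum_deg_pred_off a; rewrite off3 in E.
have d4 v : v != a -> deg v <= 4 by move=> /deg_le_off; rewrite off3.
have card1 : \sum_(v | v != a) 1 = n.-1.
  by rewrite sum1_card; have := cardC1 a; rewrite nG => <-.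
have [[b /andP[ba /eqP db]]|no4] :=
  altP (@existsP _ (fun b => (b != a) && (deg b == 4))).
  rewrite (bigD1 b) //= db in E; rewrite (bigD1 b) //= db.
  have {}card1 : \sum_(v | (v != a) && (v != b)) 1 = n - 2.
    by rewrite (bigD1 b) //= in card1; lia.
  have le1 v : (v != a) && (v != b) -> (deg v).-1 <= 1.
    move=> vab; move: E; rewrite (bigD1 v) //=; lia.
  apply: (@leq_trans (4 * 4 ^ 2 +
      \sum_(v | (v != a) && (v != b)) (1 + 7 * (deg v).-1))).
    apply: leq_add => //; apply: leq_sum => v /le1; have := deg_gt0' v.
    by case: (deg v) => [|[|[|]]].
  by rewrite big_split /= -big_distrr /= card1; lia.
apply: (@leq_trans (\sum_(v | v != a) (1 + 13 * (deg v).-1))).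
  apply: leq_sum => v va; have := deg_gt0' v; have := d4 v va.
  have: deg v != 4 by apply: contra no4 => dv; apply/existsP; exists v; rewrite va.
  by case: (deg v) => [|[|[|[|[|]]]]].
by rewrite big_split /= -big_distrr /= card1 E; lia.
Qed.

End Excess.
End EdgeCounting.

(** * Numerical inequalities *)

(* The sporadic pairs (number of vertices, bound on the mean edge weight) outside
   the range of [pow_le_large] and [pow_le_off]. *)
Lemma pow_le_small n Q :
  (n, Q) \in [:: (5, 8); (6, 8); (6, 14); (7, 20); (8, 22); (8, 26); (9, 32);
                 (9, 33); (10, 32); (10, 44); (11, 44); (12, 44)] ->
  Q ^ n <= ((n - 2) ^ 2 + 1) ^ (n - 2) * (13 * 10).
Proof.
rewrite !inE; do ![case/orP]; move/eqP=> [-> ->];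
  by rewrite !subSS subn0 !expnS !expn0; lia.
Qed.

(** As Q/M <= 7/13, with equality at n = 7 and D = 3, it suffices that Q^2 (7/13)^(n-2) <= 130,
    where 4Q = (2D + 1)^2 + 7 <= n^2 + 7. *)
Lemma pow_le_large n D : (7 <= n)%N -> (2 * D < n)%N ->
  ((D ^ 2 + D + 2) ^ n <= ((n - 2) ^ 2 + 1) ^ (n - 2) * (13 * 10))%N.
Proof.
move=> n7 Dn; set Q := D ^ 2 + D + 2; set M := (n - 2) ^ 2 + 1.
have hQ : (4 * Q <= n ^ 2 + 7)%N by rewrite /Q; nia.
have hr : (13 * Q <= 7 * M)%N by rewrite /Q /M; nia.
(* Here n = k + 7; the squared factor grows by a ratio of at most 13/7 per step. *)
have hpow k : ((k + 7) ^ 2 + 7) ^ 2 * 7 ^ (k + 5) <=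
    16 * (13 * 10) * 13 ^ (k + 5).
  elim: k => [|k IH]; first by lia.
  have step : ((k.+1 + 7) ^ 2 + 7) ^ 2 * 7 <= ((k + 7) ^ 2 + 7) ^ 2 * 13.
    by rewrite !expnS !expn0; nia.
  rewrite (addSn k 5) !(expnS _ (k + 5)).
  have := leq_mul step (leqnn (7 ^ (k + 5))); have := leq_mul (leqnn 13) IH.
  move: (((k.+1 + 7) ^ 2 + 7) ^ 2) (((k + 7) ^ 2 + 7) ^ 2) (7 ^ (k + 5)) => x y z.
  by move: (13 ^ _) => t; lia.
have e2 : n - 7 + 5 = n - 2 by lia.
have {}hpow := hpow (n - 7); rewrite e2 subnK // in hpow.
have hrn : (13 * Q) ^ (n - 2) <= (7 * M) ^ (n - 2) by rewrite leq_exp2r //; lia.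
have hQ2 : 16 * Q ^ 2 <= (n ^ 2 + 7) ^ 2 by have := leq_mul hQ hQ; lia.
rewrite !expnMn in hrn.
have -> : Q ^ n = Q ^ 2 * Q ^ (n - 2) by rewrite -expnD subnKC //; lia.
have p13 : 0 < 16 * 13 ^ (n - 2) by rewrite muln_gt0 expn_gt0.
rewrite -(leq_pmul2l p13).
move: (Q ^ (n-2)) (M ^ (n-2)) (7 ^ (n-2)) (13 ^ (n-2)) hrn hpow => q M' s t h1 h2.
have := leq_mul hQ2 h1; have := leq_mul h2 (leqnn M').
by move: (Q ^ 2) ((n ^ 2 + 7) ^ 2) => A B; lia.
Qed.

(** For m < 8 the worst case D = 7 is computed. From m = 8 on, M >= 2Q and Q^2 <= 130 * 2^(m-2); the
    latter fails for m from 3 to 7. *)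
Lemma pow_le_off m D : (3 <= m <= D)%N -> (7 <= D)%N ->
  (((m + 1) ^ 2 + 4) ^ m <= ((D + m - 2) ^ 2 + 1) ^ (m - 2) * (13 * 10))%N.
Proof.
case/andP=> m3 mD D7.
have [m8|m8] := leqP 8 m; last first.
  apply: (@leq_trans (((7 + m - 2) ^ 2 + 1) ^ (m - 2) * (13 * 10))); last first.
    rewrite leq_mul2r /= leq_exp2r ?leq_add2r ?leq_exp2r //; lia.
  have : m = 3 \/ m = 4 \/ m = 5 \/ m = 6 \/ m = 7 by lia.
  by case=> [|[|[|[|]]]] ->; rewrite !subSS !subn0 !expnS !expn0; lia.
set Q := (m + 1) ^ 2 + 4; set M := (D + m - 2) ^ 2 + 1.
have hr : (2 * Q <= M)%N by rewrite /Q /M; nia.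
have hpow : forall k, ((k + 9) ^ 2 + 4) ^ 2 <= 13 * 10 * 2 ^ (k + 6).
  elim=> [|k IH]; first by lia.
  have step : ((k.+1 + 9) ^ 2 + 4) ^ 2 <= ((k + 9) ^ 2 + 4) ^ 2 * 2.
    by rewrite !expnS !expn0; nia.
  by apply: leq_trans step _; rewrite addSn (expnS _ (k + 6)) mulnCA mulnC leq_mul2l.
have e1 : m - 8 + 9 = m + 1 by lia.
have e2 : m - 8 + 6 = m - 2 by lia.
have {}hpow := hpow (m - 8); rewrite e1 e2 -/Q in hpow.
have hrn : (2 * Q) ^ (m - 2) <= M ^ (m - 2) by rewrite leq_exp2r //; lia.
rewrite expnMn in hrn.
have -> : Q ^ m = Q ^ 2 * Q ^ (m - 2) by rewrite -expnD subnKC //; lia.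
have := leq_mul hpow (leqnn (Q ^ (m - 2))).
have := leq_mul (leqnn (13 * 10)) hrn.
by move: (Q ^ 2) (Q ^ (m-2)) (M ^ (m-2)) (2 ^ (m-2)) => A B E F; lia.
Qed.

Local Open Scope ring_scope.

(** * Concavity and AM-GM for the power function *)

Section Power.
Variables (R : realType) (alpha : R).
Hypotheses (alpha_gt0 : 0 < alpha) (alpha_lt1 : alpha < 1).

Definition natpow (k : nat) : R := k%:R `^ alpha.

Lemma natpow_gt0 k : (0 < k)%N -> 0 < natpow k.
Proof. by move=> k0; rewrite powR_gt0 ?ltr0n. Qed.

Lemma leq_natpow j k : (j <= k)%N -> natpow j <= natpow k.
Proof. by move=> jk; apply: ge0_ler_powR; rewrite ?nnegrE ?ler0n ?ler_nat // ltW. Qed.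

Lemma ltn_natpow j k : (j < k)%N -> natpow j < natpow k.
Proof. by move=> jk; apply: gt0_ltr_powR; rewrite ?nnegrE ?ler0n ?ltr_nat. Qed.

Lemma natpowM j k : natpow (j * k) = natpow j * natpow k.
Proof. by rewrite /natpow natrM powRM ?ler0n. Qed.

(* With capitals for the powers, this is (U - X)(U - Y) >= 0 and XY <= UV. *)
Lemma natpow_add_le x y u v :
  (0 < u)%N -> (x <= u)%N -> (y <= u)%N -> (x * y <= u * v)%N ->
  natpow x + natpow y <= natpow u + natpow v.
Proof.
move=> u0 /leq_natpow xu /leq_natpow yu /leq_natpow; rewrite !natpowM => h.
have := natpow_gt0 u0; nra.
Qed.

Lemma natpow_expR k : (0 < k)%N -> natpow k = expR (alpha * ln k%:R).
Proof. by move=> k0; rewrite /natpow /powR pnatr_eq0 eqn0Ngt k0. Qed.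

(* Bernoulli's inequality: with L = ln (x / Q), it is a convex combination of
   e^t >= 1 + t at t = (1 - alpha) L and at t = - alpha L. *)
Lemma natpow_le_tangent x Q : (0 < Q)%N ->
  natpow x <= natpow Q + alpha * (natpow Q / Q%:R) * (x%:R - Q%:R).
Proof.
move=> Q0; have fQ := natpow_gt0 Q0; have Q0' : 0 < Q%:R :> R by rewrite ltr0n.
case: x => [|x].
  have -> : natpow 0 = 0 by rewrite /natpow powR0 ?lt0r_neq0.
  have -> : alpha * (natpow Q / Q%:R) * (0 - Q%:R) = - (alpha * natpow Q).
    by field; rewrite lt0r_neq0.
  by rewrite subr_ge0 ler_piMl // ltW.
set X : R := x.+1%:R; have X0 : 0 < X by rewrite ltr0n.
pose L := ln X - ln Q%:R.
have fx : natpow x.+1 = natpow Q * expR (alpha * L).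
  by rewrite !natpow_expR // -expRD -mulrDr /L subrKC.
have XQ : X / Q%:R = expR (alpha * L) * expR ((1 - alpha) * L).
  rewrite -expRD -mulrDl subrKC mul1r expRB !lnK ?posrE //.
have e1 := expR_ge1Dx ((1 - alpha) * L).
have e2 := expR_ge1Dx (- (alpha * L)).
rewrite expRN in e2.
have E0 := expR_gt0 (alpha * L).
rewrite fx (_ : _ + _ = natpow Q * (1 + alpha * (X / Q%:R - 1))); last first.
  by field; rewrite lt0r_neq0.
rewrite ler_pM2l // XQ.
set E := expR (alpha * L) in E0 e2 *; set F := expR _ in e1 *.
have e3 : (1 - alpha * L) * E <= 1 by rewrite -ler_pdivlMr // div1r.
have e4 : (1 + (1 - alpha) * L) * E <= F * E by rewrite ler_pM2r.
have b0 : 0 <= 1 - alpha by rewrite subr_ge0 ltW.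
have := ler_wpM2l b0 e3; have := ler_wpM2l (ltW alpha_gt0) e4; lra.
Qed.

(** Jensen's inequality: add the tangent bounds at [Q]. The slope is positive, so an upper bound [Q]
    of the mean is enough. *)
Lemma sum_natpow_le_mean (I : finType) (E : {set I}) (w : I -> nat) Q : (0 < Q)%N ->
  (\sum_(e in E) w e <= #|E| * Q)%N ->
  \sum_(e in E) natpow (w e) <= #|E|%:R * natpow Q.
Proof.
move=> Q0 le.
apply: le_trans (ler_sum _ (fun e _ => natpow_le_tangent (w e) Q0)) _.
rewrite big_split /= sumr_const mulr_natl gerDl -mulr_sumr sumrB sumr_const -mulrnA.
apply: mulr_ge0_le0.
  by rewrite !mulr_ge0 ?invr_ge0 ?ler0n ?(ltW alpha_gt0) ?(ltW (natpow_gt0 Q0)).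
by rewrite subr_le0 -natr_sum ler_nat mulnC.
Qed.

Lemma natpow_ge_log y Q : (0 < y)%N -> (0 < Q)%N ->
  natpow Q * (1 + alpha * (ln y%:R - ln Q%:R)) <= natpow y.
Proof.
move=> y0 Q0.
have -> : natpow y = natpow Q * expR (alpha * (ln y%:R - ln Q%:R)).
  by rewrite !natpow_expR // -expRD -mulrDr subrKC.
by rewrite ler_pM2l ?natpow_gt0 // expR_ge1Dx.
Qed.

(** Add [natpow_ge_log] for [M], taken n - 2 times, for [x] and for [y]; by the hypothesis the
    logarithmic terms have a nonnegative sum. *)
Lemma natpow_amgm n Q M x y :
  (2 <= n)%N -> (0 < Q)%N -> (0 < M)%N -> (0 < x)%N -> (0 < y)%N ->
  (Q ^ n <= M ^ (n - 2) * (x * y))%N ->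
  n%:R * natpow Q <= (n - 2)%:R * natpow M + natpow x + natpow y.
Proof.
move=> n2 Q0 M0 x0 y0 le.
have lnle : n%:R * ln Q%:R <= (n - 2)%:R * ln M%:R + ln x%:R + ln y%:R :> R.
  rewrite !mulr_natl -!lnXn ?ltr0n // -addrA -!lnM ?posrE ?mulr_gt0 ?exprn_gt0 ?ltr0n //.
  by rewrite ler_ln ?posrE ?mulr_gt0 ?exprn_gt0 ?ltr0n // -!natrX -!natrM ler_nat.
have hM := natpow_ge_log M0 Q0; have hx := natpow_ge_log x0 Q0.
have hy := natpow_ge_log y0 Q0.
have fQ := natpow_gt0 Q0.
have nE : n%:R = (n - 2)%:R + 2 :> R by rewrite natrB // subrK.
have n2' : 0 <= (n - 2)%:R :> R by rewrite ler0n.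
rewrite nE in lnle *; move: (n - 2)%:R lnle n2' => k lnle k0.
have := ler_wpM2l k0 hM.
have : 0 <= alpha * natpow Q * (k * ln M%:R + ln x%:R + ln y%:R - (k + 2) * ln Q%:R).
  by rewrite mulr_ge0 ?subr_ge0 // mulr_ge0 ?ltW.
lra.
Qed.

End Power.

(** * Values of the Sombor index *)

Local Open Scope ring_scope.

Section DoubleSum.
Variables (R : realType) (alpha : R).
Local Notation f := (natpow alpha).

(** Ordered pairs count each edge twice. The free labelling [g] allows a subgraph to be evaluated
    with the degrees of the whole graph. *)
Definition pair_sum (G : sgraph) (g : G -> nat) : R :=
  \sum_x \sum_(y | adj x y) f (g x ^ 2 + g y ^ 2).

Lemma sum_edges_at (G : sgraph) (x : G) :
  \sum_(e in edges_at x) f (\sum_(v in e) deg v ^ 2)%N =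
  \sum_(y | adj x y) f (deg x ^ 2 + deg y ^ 2).
Proof.
have -> : edges_at x = [set [set x; y] | y in [set y | adj x y]].
  apply/setP => e; rewrite inE; apply/andP/imsetP.
    case=> /edgesP[u [v [-> uv]]]; rewrite !inE => /orP[]/eqP->.
      by exists v; rewrite ?inE.
    by exists u; rewrite ?inE 1?setUC // adj_sym.
  by case=> y; rewrite inE => xy ->; rewrite mem_edges xy !inE eqxx.
rewrite big_imset /=; last by move=> y z _ _ /set2_inj[[]//|[<- ->]].
by apply: eq_big => [y|y]; rewrite inE // => xy; rewrite sum_endpoints.
Qed.

Lemma SO_pair_sum (G : sgraph) : SO alpha G *+ 2 = pair_sum (@deg G).
Proof.
pose w (e : {set G}) := (\sum_(v in e) deg v ^ 2)%N.
transitivity (\sum_(e in edges G) \sum_(x in e) f (w e)).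
  rewrite -sumrMnl; apply: eq_bigr => e /edgesP[x [y [-> xy]]].
  by rewrite sumr_const cards2 (adj_neq xy).
rewrite (exchange_big_dep predT) //=; apply: eq_bigr => x _.
by rewrite -sum_edges_at; apply: eq_bigl => e; rewrite inE.
Qed.

Lemma SO_isomorphic (G H : sgraph) : isomorphic G H -> SO alpha G = SO alpha H.
Proof.
case=> h [bijh adjh]; apply: (@pmulrnI _ 2 isT); rewrite /= !SO_pair_sum.
have degh x : deg (h x) = deg x.
  rewrite /deg -(on_card_preimset (f := h)); last exact: onW_bij.
  by apply: eq_card => y; rewrite !inE adjh.
rewrite /pair_sum (reindex h); last exact: onW_bij.
apply: eq_bigr => x _; rewrite [RHS](reindex h) /=; last exact: onW_bij.
by apply: eq_big => y; rewrite ?adjh // => _; rewrite !degh.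
Qed.

Lemma pair_sum_attach (G : sgraph) (v : G) m (g : attach_pendants v m -> nat) :
  pair_sum g = pair_sum (g \o inl) +
    (\sum_(i < m) f (g (inl v) ^ 2 + g (inr i) ^ 2)) *+ 2.
Proof.
rewrite /pair_sum big_sumType /= mulr2n addrA.
congr (_ + _); last first.
  apply: eq_bigr => i _; rewrite big_sumType /= [X in _ + X]big_pred0_eq addr0.
  by rewrite big_pred1_eq addnC.
under eq_bigr do rewrite big_sumType /=.
rewrite big_split /=; congr (_ + _).
rewrite (bigD1 v) //= [X in _ + X]big1 ?addr0; last first.
  by move=> x xv; rewrite big_pred0 // => i; apply: negPf.
by apply: eq_bigl => i; rewrite eqxx.
Qed.

Lemma pair_sum_triangle (g : triangle -> nat) :
  let c : triangle := @Ordinal 3 2 isT in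
  pair_sum g = (f (g tri_a ^ 2 + g tri_b ^ 2) + f (g tri_a ^ 2 + g c ^ 2) +
    f (g tri_b ^ 2 + g c ^ 2)) *+ 2.
Proof.
move=> c; rewrite /pair_sum.
have big3 (F : 'I_3 -> R) : \sum_x F x = F tri_a + F tri_b + F c.
  rewrite !big_ord_recl big_ord0 addr0 addrA.
  by congr (F _ + F _ + F _); apply: val_inj.
rewrite big3 !(big_mkcond (fun y => adj _ y)) /= !big3 /= !addr0 !add0r.
rewrite ![(g tri_b ^ 2 + g tri_a ^ 2)%N]addnC ![(g c ^ 2 + _)%N]addnC.
by rewrite mulr2n; ring.
Qed.

Lemma degE (G : sgraph) (x : G) : deg x = (\sum_y adj x y)%N.
Proof.
by rewrite /deg -sum1_card big_mkcond; apply: eq_bigr => y _; rewrite inE; case: adj.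
Qed.

Lemma deg_attach_inl (G : sgraph) (v x : G) m :
  deg (inl x : attach_pendants v m) = (deg x + m * (x == v))%N.
Proof.
by rewrite !degE big_sumType /= sum_nat_const card_ord.
Qed.

Lemma deg_attach_inr (G : sgraph) (v : G) m i :
  deg (inr i : attach_pendants v m) = 1%N.
Proof.
rewrite degE big_sumType /= big1_eq addn0 (bigD1 v) //= eqxx big1 // => x xv.
by rewrite (negPf xv).
Qed.

Lemma deg_triangle (x : triangle) : deg x = 2%N.
Proof. by rewrite degE !big_ord_recl big_ord0 /=; case: x => [[|[|[|]]]]. Qed.

Lemma SO_C2_3 p : SO alpha (C2_3 p) =
  f ((p + 2) ^ 2 + 4) *+ 2 + f ((p + 2) ^ 2 + 1) *+ p + f 8.
Proof.
apply: (@pmulrnI _ 2 isT); rewrite /= SO_pair_sum pair_sum_attach.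
rewrite pair_sum_triangle /= !deg_attach_inl !deg_triangle /= muln1 !muln0 !addn0.
under eq_bigr do rewrite deg_attach_inr.
rewrite sumr_const card_ord ![(2 + p)%N]addnC.
rewrite -mulrnDl; congr (_ *+ 2); rewrite mulr2n.
by rewrite addrAC.
Qed.

(** The degrees of a, b, c are p + 2, 3, 2. The terms belong, in order, to ab, ac, the pendants at
    a, bc and the pendant at b. *)
Lemma SO_C3_3 p : SO alpha (C3_3 p 1) =
  f ((p + 2) ^ 2 + 9) + f ((p + 2) ^ 2 + 4) + f ((p + 2) ^ 2 + 1) *+ p + f 13 + f 10.
Proof.
apply: (@pmulrnI _ 2 isT); rewrite /= SO_pair_sum !pair_sum_attach.
rewrite pair_sum_triangle /= !deg_attach_inl !deg_triangle /= !muln1 !muln0 !addn0.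
under eq_bigr do rewrite deg_attach_inl deg_attach_inr addn0.
rewrite big_ord1 deg_attach_inr sumr_const card_ord ![(2 + p)%N]addnC.
rewrite -!mulrnDl; congr (_ *+ 2).
by congr (_ + _); rewrite addrAC.
Qed.

End DoubleSum.

Lemma isomorphic_of_inj (G H : sgraph) (h : H -> G) : #|G| = #|H| -> injective h ->
  (forall x y, adj (h x) (h y) = adj x y) -> isomorphic G H.
Proof.
move=> cGH injh adjh.
have [k hk kh] : bijective h by apply: inj_card_bij; rewrite ?cGH.
exists k; split; first by exists h.
by move=> x y; rewrite -adjh !kh.
Qed.

(** * The graphs with a vertex of degree n-1 or n-2 *)

Local Close Scope ring_scope.

Section Structure.
Variables (G : sgraph) (n : nat) (a : G).
Hypotheses (n_ge4 : 4 <= n) (nG : #|G| = n) (uG : unicyclic G).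

Let conG : connected_graph G := uG.1.
Let eG : #|edges G| = n. Proof. by rewrite unicyclic_card_edges. Qed.
Let deg_pos (v : G) : 0 < deg v. Proof. by rewrite deg_gt0 ?nG; try lia. Qed.

Lemma deg_off_sum : deg a + off a = n.
Proof. by rewrite card_edges_off eG. Qed.

Lemma isomorphic_C2_3 : deg a = n.-1 -> isomorphic G (C2_3 (n - 3)).
Proof.
move=> da.
have adja y : adj a y = (y != a).
  have/eqP/setP/(_ y) : [set y | adj a y] == [set~ a].
    rewrite eqEcard cardsC1 nG -/(deg a) da leqnn andbT.
    by apply/subsetP=> z; rewrite !inE eq_sym => /adj_neq.
  by rewrite !inE.
have /eqP/cards1P[e offE] : off a = 1 by have := deg_off_sum; lia.
have : e \in edges_off a by rewrite offE inE.
rewrite inE => /andP[_ /edgesP[b [c [eE bc]]]]; subst e.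
have : [set b; c] \in edges_off a by rewrite offE inE.
rewrite mem_edges_off => /and3P[_ ba ca]; have nbc := adj_neq bc.
have adjoff x y : x != a -> y != a ->
    adj x y = ((x == b) && (y == c)) || ((x == c) && (y == b)).
  move=> xa ya; have := mem_edges_off a x y; rewrite xa ya !andbT => <-.
  rewrite offE inE; apply/eqP/orP.
    by case/set2_inj => [[-> ->]|[-> ->]]; rewrite !eqxx; [left|right].
  by case=> /andP[/eqP-> /eqP->] //; rewrite setUC.
pose r := enum (~: [set a; b; c]).
have Ur : uniq [:: a, b, c & r].
  rewrite /= enum_uniq !inE !mem_enum !inE !eqxx !orbT /= !negb_or.
  by rewrite eq_sym ba eq_sym ca nbc.
have rE x : x \in r -> [/\ x != a, x != b & x != c].
  by rewrite mem_enum !inE !negb_or => /andP[/andP[-> ->] ->].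
have sr : size r = n - 3.
  have c3 : #|[set a; b; c]| = 3.
    rewrite cardE (@perm_size _ _ [:: a; b; c]) //.
    apply: uniq_perm; rewrite ?enum_uniq //.
      by rewrite /= !inE negb_or eq_sym ba eq_sym ca nbc.
    by move=> x; rewrite mem_enum !inE !orbA.
  by rewrite -cardE cardsCs setCK c3 nG.
(* Positions in the list [a, b, c, r]: first the triangle, then the pendant vertices. *)
pose code (z : C2_3 (n - 3)) : nat :=
  match z with inl i => val i | inr j => 3 + val j end.
pose h z := nth a [:: a, b, c & r] (code z).
have code_lt z : code z < size [:: a, b, c & r].
  by rewrite /= sr; case: z => -[i ilt] /=; lia.
have cardH : #|C2_3 (n - 3)| = n by rewrite card_sum !card_ord; lia.
have hr j : h (inr j) \in r by rewrite -[h _]/(nth a r j) mem_nth // sr ltn_ord.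
apply: (@isomorphic_of_inj _ _ h); first by rewrite nG cardH.
  move=> z z' /eqP; rewrite /h nth_uniq // => /eqP.
  case: z z' => [i|i] [j|j] /=; try (case: i j => [i ?] [j ?] /=; lia).
    by move=> /val_inj->.
  by move=> /addnI/val_inj->.
have ab := ba; have ac := ca; have cb := nbc.
rewrite eq_sym in ab; rewrite eq_sym in ac; rewrite eq_sym in cb.
have adja' y : adj y a = (y != a) by rewrite adj_sym adja.
case=> [i|i] [j|j].
- rewrite /h /=; case: i j => [[|[|[|//]]] ?] [[|[|[|//]]] ?] /=;
    rewrite ?adja ?adja' ?adjoff ?eqxx //= ?ba ?ca ?(negPf nbc) ?(negPf cb) //.
- have [ja jb jc] := rE _ (hr j).
  case: i => [[|[|[|//]]] ?]; rewrite {1}/h /=;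
    by rewrite ?adja ?adja' ?adjoff ?eqxx //= ?ja ?(negPf jb) ?(negPf jc) ?andbF.
- have [ja jb jc] := rE _ (hr i).
  case: j => [[|[|[|//]]] ?]; rewrite {2}/h /=;
    by rewrite ?adja ?adja' ?adjoff ?eqxx //= ?ja ?(negPf jb) ?(negPf jc) ?andbF.
- have [ja jb jc] := rE _ (hr j); have [ia ib ic] := rE _ (hr i).
  by rewrite adjoff // (negPf ib) (negPf ic).
Qed.

(** Exactly one vertex [w] is not joined to [a], and two edges avoid [a]. Both must meet [b], so [b]
    is joined to [a]; one of them goes to [w], which has no other possible neighbour, and the other
    to the third triangle vertex [c]. *)
Lemma isomorphic_C3_3 b : deg a = n - 2 -> b != a -> 3 <= deg b ->
  isomorphic G (C3_3 (n - 4) 1).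
Proof.
move=> da ba db.
have [w [wa adja]] : exists w, w != a /\ forall y, adj a y = (y != a) && (y != w).
  have : #|(~: [set y | adj a y]) :\ a| = 1.
    have := cardsC [set y | adj a y]; rewrite -/(deg a) da nG.
    rewrite (cardsD1 a) !inE adj_irrefl /=; lia.
  case/eqP/cards1P=> w /setP wE; exists w.
  have := wE w; rewrite !inE eqxx => /andP[wa _]; split=> // y.
  have := wE y; rewrite !inE; case: (eqVneq y a) => [->|] /=.
    by rewrite adj_irrefl.
  by move=> _ <-; rewrite negbK.
have off2 : off a = 2 by have := deg_off_sum; lia.
have offb : edges_at b :\: edges_at a = edges_off a.
  apply/eqP; rewrite eqEcard edges_at_off_sub -/(off a) off2.
  by have := card_edges_at_off ba; lia.
have off_b e : e \in edges_off a -> b \in e.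
  by rewrite -offb !inE => /andP[_ /andP[]].
have adjab : adj a b.
  apply: contraLR db => nab; rewrite -ltnNge ltnS -off2 /off -offb -card_edges_at.
  rewrite -(cardsID (edges_at a) (edges_at b)) (_ : _ :&: _ = set0) ?cards0 //.
  apply/eqP; rewrite -subset0; apply/subsetP=> e eab.
  have := subsetP (edges_at_cap ba) e eab; rewrite inE => /eqP eE.
  by move: eab; rewrite eE !inE mem_edges adj_sym (negPf nab).
have bw : b != w by move: adjab; rewrite adja => /andP[].
have wb : w != b by rewrite eq_sym.
have adjbw : adj b w.
  have := deg_pos w; rewrite card_gt0 => /set0Pn[u]; rewrite inE => wu.
  have ua : u != a by apply: contraTneq wu => ->; rewrite adj_sym adja eqxx andbF.
  have : [set w; u] \in edges_off a by rewrite mem_edges_off wu wa ua.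
  by move/off_b; rewrite !inE (negPf bw) /= => /eqP->; rewrite adj_sym.
have bw_off : [set b; w] \in edges_off a by rewrite mem_edges_off adjbw ba wa.
have [c [cw ca bc offE]] : exists c, [/\ c != w, c != a, adj b c &
    edges_off a = [set [set b; w]; [set b; c]]].
  have : #|edges_off a :\ [set b; w]| = 1.
    by have := cardsD1 [set b; w] (edges_off a); rewrite bw_off -/(off a) off2 => -[].
  case/eqP/cards1P=> e eE.
  have : e \in edges_off a :\ [set b; w] by rewrite eE inE.
  rewrite in_setD1 => /andP[nbw eoff]; have be := off_b _ eoff.
  have := eoff; rewrite inE => /andP[_ /edgesP[x [y [xyE _]]]].
  have [c ecE] : exists c, e = [set b; c].
    move: be; rewrite xyE !inE => /orP[]/eqP->; first by exists y.
    by exists x; rewrite setUC.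
  exists c; move: eoff nbw; rewrite ecE mem_edges_off => /and3P[bc _ ca] nbw; split=> //.
    by apply: contraNneq nbw => ->.
  by rewrite -(setD1K bw_off) eE ecE.
have cb := adj_neq bc; rewrite eq_sym in cb; have nbc := adj_neq bc.
have adjoff x y : x != a -> y != a -> adj x y =
    ((x == b) && ((y == w) || (y == c))) || ((y == b) && ((x == w) || (x == c))).
  move=> xa ya; have := mem_edges_off a x y; rewrite xa ya !andbT => <-.
  rewrite offE !inE; apply/orP/orP.
    by case=> /eqP/set2_inj[[-> ->]|[-> ->]]; rewrite !eqxx ?orbT; auto.
  by case=> /andP[/eqP-> /orP[]/eqP->]; rewrite ?eqxx; auto;
    rewrite [[set _; b]]setUC eqxx; auto.
have ab : a != b by rewrite eq_sym.
have aw : a != w by rewrite eq_sym.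
have ac : a != c by rewrite eq_sym.
have wc : w != c by rewrite eq_sym.
pose r := enum (~: [set a; b; c; w]).
have Ur : uniq [:: a, b, c, w & r].
  by rewrite /= enum_uniq !inE !mem_enum !inE !eqxx !orbT /= !negb_or ab ac aw nbc bw cw.
have rE x : x \in r -> [/\ x != a, x != b, x != c & x != w].
  by rewrite mem_enum !inE !negb_or => /andP[/andP[/andP[-> ->] ->] ->].
have sr : size r = n - 4.
  have c4 : #|[set a; b; c; w]| = 4.
    rewrite cardE (@perm_size _ _ [:: a; b; c; w]) //.
    apply: uniq_perm; rewrite ?enum_uniq //.
      by rewrite /= !inE !negb_or ab ac aw nbc bw cw.
    by move=> x; rewrite mem_enum !inE !orbA.
  by rewrite -cardE cardsCs setCK c4 nG.
(* Position 3 is [w], the pendant vertex at [b]; the pendants at [a] follow. *)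
pose code (z : C3_3 (n - 4) 1) : nat :=
  match z with
  | inl (inl i) => val i | inl (inr j) => 4 + val j | inr _ => 3
  end.
pose h z := nth a [:: a, b, c, w & r] (code z).
have code_lt z : code z < size [:: a, b, c, w & r].
  by rewrite /= sr; case: z => [[]|] [i ilt] /=; move: ilt n_ge4; clear; lia.
have cardH : #|C3_3 (n - 4) 1| = n.
  by rewrite !card_sum !card_ord; move: n_ge4; clear; lia.
have hr j : h (inl (inr j)) \in r by rewrite -[h _]/(nth a r j) mem_nth // sr ltn_ord.
apply: (@isomorphic_of_inj _ _ h); first by rewrite nG cardH.
  move=> z z' /eqP; rewrite /h nth_uniq // => /eqP.
  case: z z' => [[i|i]|i] [[j|j]|j] /=; try (case: i j => [i +] [j +] /=; clear; lia).
  - by move=> /val_inj->.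
  - by move=> /addnI/val_inj->.
  - by rewrite !ord1.
have adja' y : adj y a = (y != a) && (y != w) by rewrite adj_sym adja.
have hw i : h (inr i) = w by [].
have triE (i : 'I_3) : [\/ i = tri_a, i = tri_b | i = @Ordinal 3 2 isT].
  case: i => [[|[|[|//]]] ?]; [constructor 1|constructor 2|constructor 3];
    exact: val_inj.
have ha : h (inl (inl tri_a)) = a by [].
have hb : h (inl (inl tri_b)) = b by [].
have hc : h (inl (inl (@Ordinal 3 2 isT))) = c by [].
pose simp := (adja, adja', eqxx, hw, ha, hb, hc,
  (negPf ba, negPf ca, negPf wa), (negPf ab, negPf ac, negPf aw),
  (negPf bw, negPf wb, negPf cb), (negPf nbc, negPf cw, negPf wc), andbF, orbF).
have simpr j := (let: And4 ja jb jc jw := rE _ (hr j) in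
  (negPf ja, negPf jb, negPf jc, negPf jw)).
case=> [[i|i]|i] [[j|j]|j].
- by case: (triE i) => ->; case: (triE j) => ->; rewrite !simp ?adjoff ?simp.
- by case: (triE i) => ->; rewrite !simp ?adjoff ?(simpr j) ?simp.
- by case: (triE i) => ->; rewrite !simp ?adjoff ?simp.
- by case: (triE j) => ->; rewrite !simp ?adjoff ?(simpr i) ?simp.
- by rewrite adjoff ?(simpr i) ?(simpr j).
- by rewrite hw adjoff ?(simpr i) ?simp.
- by case: (triE j) => ->; rewrite !simp ?adjoff ?simp.
- by rewrite hw adjoff ?(simpr j) ?simp.
- by rewrite !hw adj_irrefl.
Qed.

End Structure.

(** * Bounds on the Sombor index *)

Lemma dist_le (G : sgraph) (x y : G) k :
  k < #|G| -> has_walk k x y -> dist x y <= k.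
Proof.
move=> kG wk; rewrite leqNgt; apply/negP => lt.
by have := before_find 0 lt; rewrite nth_iota // add0n wk.
Qed.

Lemma diameter_le2 (G : sgraph) (a : G) : 2 < #|G| ->
  (forall x, x != a -> adj a x) -> diameter G <= 2.
Proof.
move=> G2 adja; apply/bigmax_leqP => x _; apply/bigmax_leqP => y _.
have adja' z : z != a -> adj z a by rewrite adj_sym; apply: adja.
have walk s : path adj x s -> last x s = y -> size s <= 2 -> dist x y <= 2.
  move=> xs sy s2; apply: (@leq_trans (size s)) => //.
  apply: dist_le; first exact: leq_ltn_trans G2.
  by apply/existsP; exists (in_tuple s); rewrite xs sy eqxx.
have [xy|nxy] := eqVneq x y; first exact: (walk [::]).
have [xa|xa] := eqVneq x a; last have [ya|ya] := eqVneq y a.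
- by apply: (walk [:: y]) => //=; rewrite xa adja // -xa eq_sym.
- by apply: (walk [:: y]) => //=; rewrite ya adja'.
by apply: (walk [:: a; y]) => //=; rewrite adja' ?adja.
Qed.

Section Bounds.
Variables (R : realType) (alpha : R).
Hypotheses (alpha_gt0 : (0 < alpha)%R) (alpha_lt1 : (alpha < 1)%R).
Variables (G : sgraph) (n : nat) (a : G).
Hypotheses (n_ge4 : 4 <= n) (nG : #|G| = n) (uG : unicyclic G).
Hypothesis amax : forall v : G, deg v <= deg a.

Local Notation f := (natpow alpha).
Let conG : connected_graph G := uG.1.
Let eG : #|edges G| = n. Proof. by rewrite unicyclic_card_edges. Qed.
Let weight (e : {set G}) := \sum_(v in e) deg v ^ 2.

Local Open Scope ring_scope.

Lemma SO_split : SO alpha G =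
  \sum_(e in edges_at a) f (weight e) + \sum_(e in edges_off a) f (weight e).
Proof.
rewrite /SO (big_setID (edges_at a)) /=; congr (_ + _).
apply: eq_bigl => e; congr (e \in pred_of_set _).
by apply/setIidPr/subsetP=> e'; rewrite inE => /andP[].
Qed.

Lemma SO_le_mean Q : (0 < Q)%N -> (\sum_(v : G) deg v * deg v ^ 2 <= n * Q)%N ->
  SO alpha G <= n%:R * f Q.
Proof.
move=> Q0 le; rewrite -eG; apply: sum_natpow_le_mean => //.
by rewrite sum_edges_endpoints eG.
Qed.

(** Lowering the weights of the triangle edges at a to that of a pendant edge gives the form of the
    AM-GM bound, and the strictness. *)
Lemma SO_C3_3_gt : (n - 2)%:R * f ((n - 2) ^ 2 + 1) + f 13 + f 10 <
  SO alpha (C3_3 (n - 4) 1).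
Proof.
rewrite SO_C3_3 (_ : n - 4 + 2 = n - 2)%N; last by lia.
rewrite -mulr_natl (_ : n - 2 = (n - 4) + 2)%N; last by lia.
set k := (n - 4)%N; set N := ((k + 2) ^ 2)%N; rewrite natrD.
have := ltn_natpow alpha_gt0 (_ : N + 1 < N + 9)%N.
have := ltn_natpow alpha_gt0 (_ : N + 1 < N + 4)%N.
by rewrite !ltn_add2l => /(_ isT) h1 /(_ isT) h2; lra.
Qed.

Lemma exists_mean_weight : (deg a + 3 <= n)%N -> ~~ ((7 <= deg a) && (off a <= deg a))%N ->
  exists2 Q, (0 < Q)%N & (\sum_(v : G) deg v * deg v ^ 2 <= n * Q)%N /\
    (Q ^ n <= ((n - 2) ^ 2 + 1) ^ (n - 2) * (13 * 10))%N.
Proof.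
move=> aD; rewrite negb_and -!ltnNge => case2.
have n1 : (1 < n)%N by lia.
have aoff := deg_off_sum a nG uG.
(* The mean degree is 2. *)
have a2 : (2 <= deg a)%N.
  have : (\sum_(v : G) deg v <= \sum_(v : G) deg a)%N by apply: leq_sum.
  rewrite sum_deg eG sum_nat_const [X in (_ <= X * _)%N]nG mulnC leq_pmul2l //; lia.
have cube := sum_cube_le conG n1 nG eG amax.
have cube3 := sum_cube_off3 conG n1 nG eG (a := a).
have sumE : (\sum_(v : G) deg v * deg v ^ 2 =
    deg a * deg a ^ 2 + \sum_(v | v != a) deg v * deg v ^ 2)%N by rewrite (bigD1 a).
move: (deg a) (off a) aD a2 case2 aoff cube cube3 sumE.
move=> D m aD a2 case2 aoff cube cube3 sumE.
move: (\sum_(v | v != a) _)%N (\sum_(v : G) _)%N cube cube3 sumE => S3 S cube cube3 sumE.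
have [Dn|nD] := ltnP (2 * D) n.
  have [n7|n7] := leqP 7 n.
    exists (D ^ 2 + D + 2)%N; first by rewrite addn2.
    by split=> //; apply: pow_le_large.
  exists 8 => //; split.
    have D2 : (D <= 2)%N by lia.
    apply: leq_trans cube _; rewrite leq_mul2l; apply/orP; right.
    by case: D D2 {aD a2 case2 aoff sumE Dn} => [|[|[|]]].
  have : (n = 5 \/ n = 6)%N by lia.
  by case=> ->; apply: pow_le_small.
have D6 : (D <= 6)%N by lia.
(* For m = 3 and D >= 4 the value D^2 + D + 2 is too large, and the sharper bound [sum_cube_off3]
   takes its place. *)
have [m3|m3] := eqVneq m 3; last first.
  exists (D ^ 2 + D + 2)%N; first by rewrite addn2.
  split=> //.
  have : (D = 4 /\ n = 8 \/ D = 5 /\ n = 9 \/ D = 5 /\ n = 10 \/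
    D = 6 /\ n = 10 \/ D = 6 /\ n = 11 \/ D = 6 /\ n = 12)%N by lia.
  case=> [[-> ->]|[[-> ->]|[[-> ->]|[[-> ->]|[[-> ->]|[-> ->]]]]]].
  - exact: (@pow_le_small 8 22).
  - exact: (@pow_le_small 9 32).
  - exact: (@pow_le_small 10 32).
  - exact: (@pow_le_small 10 44).
  - exact: (@pow_le_small 11 44).
  - exact: (@pow_le_small 12 44).
have {cube3} S3le := cube3 m3.
have : (D = 3 /\ n = 6 \/ D = 4 /\ n = 7 \/ D = 5 /\ n = 8 \/ D = 6 /\ n = 9)%N by lia.
case=> [|[|[|]]] [DE nE]; rewrite DE nE in cube sumE S3le *.
- by exists 14%N; [|split; [exact: cube|exact: (@pow_le_small 6 14)]].
- by exists 20%N; [|split; [lia|exact: (@pow_le_small 7 20)]].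
- by exists 26%N; [|split; [lia|exact: (@pow_le_small 8 26)]].
- by exists 33%N; [|split; [lia|exact: (@pow_le_small 9 33)]].
Qed.

Lemma SO_lt_of_deg_le : (deg a + 3 <= n)%N -> SO alpha G < SO alpha (C3_3 (n - 4) 1).
Proof.
move=> aD; apply: le_lt_trans SO_C3_3_gt.
have M0 : (0 < (n - 2) ^ 2 + 1)%N by rewrite addn1.
have [/andP[D7 mD]|case2] := boolP ((7 <= deg a) && (off a <= deg a))%N; last first.
  have [Q Q0 [le pow]] := exists_mean_weight aD case2.
  apply: le_trans (SO_le_mean Q0 le) _.
  by apply: natpow_amgm => //; lia.
have aoff := deg_off_sum a nG uG.
have m3 : (3 <= off a)%N by lia.
set M := ((n - 2) ^ 2 + 1)%N.
(* With m = [off a], this is D^2 + (m + 1)^2 <= (D + m - 2)^2 + 1, an equality at D = 7 and m =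
   3. *)
have at_le e : e \in edges_at a -> f (weight e) <= f M.
  rewrite inE => /andP[/edgesP[x [y [-> xy]]]] axy; apply: leq_natpow => //.
  have [z [xa ->]] : exists z, z != a /\ weight [set x; y] = (deg a ^ 2 + deg z ^ 2)%N.
    rewrite /weight sum_endpoints //.
    move: axy xy; rewrite !inE => /orP[]/eqP-> /adj_neq zz; [exists y|exists x].
      by rewrite eq_sym.
    by rewrite addnC.
  have := deg_le_off xa; rewrite /M.
  move: (deg z) (deg a) (off a) D7 mD aoff m3 => d D m D7 mD <- m3 dm.
  have dm2 : (d ^ 2 <= (m + 1) ^ 2)%N by rewrite leq_exp2r.
  have [k mE] : exists k, m = (k + 3)%N by exists (m - 3)%N; lia.
  rewrite mE in dm2 *.
  have [j ->] : exists j, D = (j + 7)%N by exists (D - 7)%N; lia.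
  rewrite (_ : j + 7 + (k + 3) - 2 = j + k + 8)%N; last by lia.
  by rewrite !expnS !expn0; nia.
(* The two degrees are at most m + 1 and their sum at most m + 3, so the extreme pair is (m + 1,
   2). *)
have off_le e : e \in edges_off a -> f (weight e) <= f ((off a + 1) ^ 2 + 4).
  move=> eo; have := eo; rewrite inE => /andP[_ /edgesP[x [y [eE xy]]]]; subst e.
  move: eo; rewrite mem_edges_off => /and3P[_ xa ya]; apply: leq_natpow => //.
  rewrite /weight sum_endpoints //.
  have := deg_le_off xa; have := deg_le_off ya.
  have := deg_add_le_off xa ya (adj_neq xy).
  move: (deg x) (deg y) (off a) m3 => d d' m m3 h1 h2 h3.
  have [d2|d2] := leqP 2 d; have [d2'|d2'] := leqP 2 d'; nia.
rewrite SO_split.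
have m2 : (1 < off a)%N by lia.
have pow := pow_le_off (introT andP (conj m3 mD)) D7.
have Q0 : (0 < (off a + 1) ^ 2 + 4)%N by rewrite addn4.
have := natpow_amgm alpha_gt0 m2 Q0 M0 (isT : 0 < 13)%N (isT : 0 < 10)%N.
rewrite -{1}aoff => /(_ pow) le.
have h1 : \sum_(e in edges_at a) f (weight e) <= (deg a)%:R * f M.
  by rewrite -card_edges_at mulr_natl -sumr_const; apply: ler_sum.
have h2 : \sum_(e in edges_off a) f (weight e) <= (off a)%:R * f ((off a + 1) ^ 2 + 4).
  by rewrite mulr_natl -sumr_const; apply: ler_sum.
have -> : (n - 2)%:R = (deg a)%:R + (off a - 2)%:R :> R.
  by rewrite -natrD; congr (_%:R); lia.
by rewrite -/M in le *; lra.
Qed.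

(** The two edges off [a] weigh at most 8, against 13 and 10. The edges at [a] weigh N + 1 or N + 4,
    the latter at most three times; two terms N + 4 are exchanged for N + 9 and N + 1, as (N + 4)^2
    <= (N + 9)(N + 1). *)
Lemma SO_lt_of_deg_sub2 : deg a = (n - 2)%N -> (forall v, v != a -> (deg v <= 2)%N) ->
  SO alpha G < SO alpha (C3_3 (n - 4) 1).
Proof.
move=> da d2.
have n1 : (1 < n)%N by lia.
have off2 : off a = 2%N by have := deg_off_sum a nG uG; lia.
rewrite SO_C3_3 (_ : n - 4 + 2 = n - 2)%N; last by lia.
set N := ((n - 2) ^ 2)%N.
have N4 : (4 <= N)%N by rewrite /N; nia.
have off_le e : e \in edges_off a -> f (weight e) <= f 8.
  move=> eo; have := eo; rewrite inE => /andP[_ /edgesP[x [y [eE xy]]]]; subst e.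
  move: eo; rewrite mem_edges_off => /and3P[_ xa ya]; apply: leq_natpow => //.
  rewrite /weight sum_endpoints //; have := d2 _ xa; have := d2 _ ya.
  by case: (deg x) => [|[|[|]]] //; case: (deg y) => [|[|[|]]].
have h2 : \sum_(e in edges_off a) f (weight e) <= f 8 *+ 2.
  by rewrite -[X in _ *+ X]off2 -sumr_const; apply: ler_sum.
rewrite SO_split sum_edges_at da -/N.
have at_eq y : adj a y -> f (N + deg y ^ 2) =
    f (N + 1) + (f (N + 4) - f (N + 1)) *+ (deg y).-1.
  move=> ay; have ya : y != a by rewrite eq_sym (adj_neq ay).
  have := d2 _ ya; have : (0 < deg y)%N by rewrite deg_gt0 // nG.
  by case: (deg y) => [|[|[|]]] //= _ _; rewrite ?addr0 // subrKC.
rewrite (eq_bigr _ at_eq) big_split /= sumr_const sumrMnr.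
have cardN : #|[pred y | adj a y]| = (n - 2)%N.
  by rewrite -da; apply: eq_card => y; rewrite !inE.
have S3 : (\sum_(y | adj a y) (deg y).-1 <= 3)%N.
  have <- : (\sum_(v | v != a) (deg v).-1 = 3)%N.
    by rewrite (sum_deg_pred_off conG n1 nG eG) off2.
  rewrite [leqRHS](bigID (adj a)) /=; apply: leq_trans (leq_addr _ _).
  rewrite leq_eqVlt; apply/orP; left; apply/eqP/eq_bigl => y.
  by rewrite andb_idl // eq_sym => /adj_neq.
have d0 : 0 <= f (N + 4) - f (N + 1) by rewrite subr_ge0 leq_natpow // leq_add2l.
have h3 := ler_wpMn2l d0 S3.
have h4 : f (N + 4) + f (N + 4) <= f (N + 9) + f (N + 1).
  by apply: natpow_add_le => //; lia.
have h5 := ltn_natpow alpha_gt0 (isT : 8 < 13)%N.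
have h6 := ltn_natpow alpha_gt0 (isT : 8 < 10)%N.
have -> : #|(fun y => adj a y)| = (n - 4 + 2)%N.
  by rewrite -[LHS]/#|[pred y | adj a y]| cardN; lia.
rewrite mulrnDr; move: h2 h3; rewrite -/weight.
set S := \sum_(e in edges_off a) _; set T := _ *+ (\sum_(y | adj a y) _)%N.
set U := f (N + 1) *+ (n - 4)%N; lra.
Qed.

Lemma SO_le_C3_3 : (deg a + 2 <= n)%N -> SO alpha G < SO alpha (C3_3 (n - 4) 1) \/
  (5 <= n)%N /\ isomorphic G (C3_3 (n - 4) 1).
Proof.
move=> aD; have [a3|a2] := leqP (deg a + 3) n; first by left; apply: SO_lt_of_deg_le.
have da : deg a = (n - 2)%N by lia.
have [/existsP[b /andP[ba b3]]|no3] := boolP [exists b, (b != a) && (3 <= deg b)%N].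
  right; split; last exact: (isomorphic_C3_3 n_ge4 nG uG da ba b3).
  by have := amax b; lia.
left; apply: SO_lt_of_deg_sub2 => // v va; rewrite leqNgt; apply: contra no3 => v3.
by apply/existsP; exists v; rewrite va.
Qed.

End Bounds.

(** * Comparison of the two extremal graphs, and conclusion *)

Local Open Scope ring_scope.

(** For n = 4 both graphs are a triangle with one pendant vertex. For larger n the terms are
    compared one by one, except that 13 and 10 are matched jointly with N' + 1 and 8, where 130 <= 8
    (N' + 1). *)
Lemma SO_C3_3_le_C2_3 (R : realType) (alpha : R) n : 0 < alpha -> (4 <= n)%N ->
  SO alpha (C3_3 (n - 4) 1) <= SO alpha (C2_3 (n - 3)) ?= iff (n == 4).
Proof.
move=> a0 n4; have [p ->] : exists p, n = (p + 4)%N by exists (n - 4)%N; lia.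
rewrite addnK (_ : p + 4 - 3 = p.+1)%N; last by lia.
rewrite SO_C3_3 SO_C2_3; apply/leifP; rewrite -{1}(add0n 4) eqn_add2r.
have [->|p0] := eqVneq p 0%N.
  rewrite mulr0n mulr1n mulr2n; apply/eqP.
  change (natpow alpha 13 + natpow alpha 8 + 0 + natpow alpha 13 + natpow alpha 10 =
    natpow alpha 13 + natpow alpha 13 + natpow alpha 10 + natpow alpha 8).
  by ring.
set N := ((p + 2) ^ 2)%N; set N' := ((p.+1 + 2) ^ 2)%N.
have NN : (N + 7 <= N')%N by rewrite /N /N'; nia.
have N9 : (9 <= N)%N by rewrite /N; nia.
have h1 : natpow alpha 13 + natpow alpha 10 <= natpow alpha (N' + 1) + natpow alpha 8.
  by apply: natpow_add_le => //; lia.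
have h2 : natpow alpha (N + 9) < natpow alpha (N' + 4) by apply: ltn_natpow => //; lia.
have h3 : natpow alpha (N + 4) < natpow alpha (N' + 4) by apply: ltn_natpow => //; lia.
have h4 : natpow alpha (N + 1) *+ p <= natpow alpha (N' + 1) *+ p.
  by rewrite lerMn2r leq_natpow ?orbT //; lia.
by rewrite mulr2n mulrS; lra.
Qed.

Theorem theorem1 (R : realType) (alpha : R) (n : nat)
    (alpha_gt0 : 0 < alpha) (alpha_lt1 : alpha < 1) (n_ge4 : (4 <= n)%N) :
  (forall G : sgraph, #|G| = n -> unicyclic G -> diameter G = 2%N ->
     SO alpha G <= SO alpha (C2_3 (n - 3)) /\
     (SO alpha G = SO alpha (C2_3 (n - 3)) <-> isomorphic G (C2_3 (n - 3))))
  /\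
  (forall G : sgraph, #|G| = n -> unicyclic G -> diameter G = 3%N ->
     SO alpha G <= SO alpha (C3_3 (n - 4) 1) /\
     (SO alpha G = SO alpha (C3_3 (n - 4) 1) <->
      isomorphic G (C3_3 (n - 4) 1))).
Proof.
have conclude (G H : sgraph) : SO alpha G < SO alpha H \/ isomorphic G H ->
    SO alpha G <= SO alpha H /\ (SO alpha G = SO alpha H <-> isomorphic G H).
  case=> [lt|iso]; last by rewrite (SO_isomorphic alpha iso).
  split; first exact: ltW.
  split=> [E|/(SO_isomorphic alpha)//]; by move: lt; rewrite E ltxx.
have maxdeg (G : sgraph) : #|G| = n -> exists a : G, forall v : G, (deg v <= deg a)%N.
  move=> nG; have /card_gt0P[x0 _] : (0 < #|G|)%N by rewrite nG; lia.
  by exists [arg max_(v > x0) deg v]; case: arg_maxnP => // a _ amax v; apply: amax.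
have deg_lt (G : sgraph) (a : G) : #|G| = n -> (deg a < n)%N.
  move=> nG; rewrite -nG /deg; apply/proper_card/properP.
  by split; [apply/subsetP | exists a; rewrite ?inE ?adj_irrefl].
split=> G nG uG dG; have [a amax] := maxdeg G nG; apply: conclude.
  have [aD|aD] := leqP (deg a + 2)%N n; last first.
    by right; apply: (@isomorphic_C2_3 _ _ a) => //; have := deg_lt G a nG; lia.
  have [le eqn] := SO_C3_3_le_C2_3 alpha_gt0 n_ge4; left.
  (* If the graph is C_3(3,n-4,1), then n >= 5 makes the comparison with C_2(3,n-3,0) strict. *)
  have [lt|[n5 /(SO_isomorphic alpha)->]] :=
    SO_le_C3_3 alpha_gt0 alpha_lt1 n_ge4 nG uG amax aD.
    exact: lt_le_trans lt le.
  by rewrite lt_neqAle le eqn; lia.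
have [aD|aD] := leqP (deg a + 2)%N n.
  by have [lt|[_ iso]] := SO_le_C3_3 alpha_gt0 alpha_lt1 n_ge4 nG uG amax aD; [left|right].
(* Here [a] has degree n - 1 and is joined to every other vertex, which contradicts diameter 3. *)
suff : (diameter G <= 2)%N by rewrite dG.
apply: (@diameter_le2 _ a); first by rewrite nG; lia.
move=> x xa.
have /eqP/setP/(_ x) : [set y | adj a y] == [set~ a].
  rewrite eqEcard cardsC1 nG -/(deg a); apply/andP; split; last by lia.
  by apply/subsetP=> z; rewrite !inE eq_sym => /adj_neq.
by rewrite !inE xa.
Qed.
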